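(* Let $\mathbb H$ be Hechler forcing. Then $\mathbb H$ is ccc, and if $\mathfrak b>\aleph_1$ then $\pi\mathrm{nt}(\mathbb H)\ge\mathfrak b$. Consequently, if every ccc separative poset $\mathbb P$ satisfies $\pi\mathrm{nt}(\mathbb P)\le S(\mathbb P)$, then $\mathfrak b=\aleph_1$.
   Context: Hechler forcing is $\mathbb H=\{(s,f):s\in\omega^{<\omega},f\in\omega^\omega\}$ with $(t,g)\le(s,f)$ iff $t$ extends $s$, $g(n)\ge f(n)$ for all $n\ge\mathrm{dom}(t)$, and $t(n)\ge f(n)$ for all $n\in\mathrm{dom}(t)\setminus\mathrm{dom}(s)$. For $f,g\in\omega^\omega$, $f\le^* g$ means $f(n)\le g(n)$ for all but finitely many $n$; $\mathfrak b$ is the least size of a $\le^*$-unbounded subset of $\omega^\omega$. For a poset $\mathbb P$ ($q\le p$ meaning $q$ extends $p$): it is separative if whenever $q\not\le p$ there is $r\le q$ incompatible with $p$; $S(\mathbb P)$ is the least $\kappa$ such that all antichains have size $<\kappa$; ccc means $S(\mathbb P)\le\aleph_1$. For $\mathbb D\subseteq\mathbb P$, $\mathrm{nt}(\mathbb D)$ is the least cardinal $\kappa$ such that for all $q\in\mathbb P$, $|\{p\in\mathbb D:q\le p\}|<\kappa$; $\pi\mathrm{nt}(\mathbb P)$ is the minimum of $\mathrm{nt}(\mathbb D)$ over dense $\mathbb D\subseteq\mathbb P$. *)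

(* Defs.v *)
From HB Require Import structures.
From mathcomp Require Import all_boot all_order.
From mathcomp Require Import boolp classical_sets functions cardinality.

Set Implicit Arguments.
Unset Strict Implicit.
Unset Printing Implicit Defensive.

Local Open Scope classical_set_scope.
Local Open Scope card_scope.

(* Cardinals are represented by types, two types standing for the same
   cardinal when they are equipotent: the relations of [cardinality] on
   [[set: K]] are the order and the equality of cardinals. *)
Definition card_lt (T U : Type) (A : set T) (B : set U) : bool :=
  (A #<= B) && ~~ (A #= B).
Notation "A '#<' B" := (card_lt A B)
  (at level 79, format "A  '#<'  B") : card_scope.

Lemma injective_card_le (T U : Type) (f : T -> U) :
  injective f -> [set: T] #<= [set: U].
Proof.
move=> finj; have fT : f @` [set: T] #= [set: T] by apply: inj_card_eq => x y _ _ /finj.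
by rewrite -(card_le_eql fT) card_leT.
Qed.

Definition is_least_card (C : Type -> Prop) (K : Type) : Prop :=
  C K /\ forall L : Type, C L -> [set: K] #<= [set: L].

(* A representative of the least cardinal in the class [C]; the default value
   is only reached when [C] is empty, see [least_cardP]. *)
Definition least_card (C : Type -> Prop) : Type :=
  if pselect (exists K, is_least_card C K) is left e then sval (cid e)
  else void.

(* Any nonempty family of types has a member of least cardinal: consider a
   maximal set of choice functions on which all the evaluation maps are
   injective; one of these maps must then be onto. *)
Lemma min_card_family (I : Type) (X : I -> Type) (i0 : I) :
  exists i, forall j, [set: X i] #<= [set: X j].
Proof.
pose T := forall i : I, X i.
pose P (F : set T) := forall (i : I) f g, F f -> F g -> f i = g i -> f = g.
have [F [PF maxF]] : exists F, P F /\ forall G, F `<` G -> ~ P G.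
  apply: Zorn_bigcup => S SP totS i f g [A SA Af] [B SB Bg].
  have [AB|BA] := totS _ _ SA SB; first exact: (SP _ SB i _ _ (AB _ Af) Bg).
  exact: (SP _ SA i _ _ Af (BA _ Bg)).
have [i iP] : exists i : I, forall x : X i, exists2 f, F f & f i = x.
  apply: contrapT => /forallNP noi.
  have newx (i : I) : {x : X i | forall f, F f -> f i <> x}.
    apply: cid; have /existsNP[x xP] := noi i.
    by exists x => f Ff fx; apply: xP; exists f.
  pose h : T := fun i => sval (newx i).
  have hP i f : F f -> f i <> h i by exact: (svalP (newx i)).
  apply: (maxF (F `|` [set h])).
    split=> [f|FhF]; first by left.
    have Fh : F h by apply: FhF; right.
    exact: hP i0 h Fh erefl.
  move=> j f g [Ff|->] [Fg|->] //; first exact: PF.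
    by move=> /(hP j f Ff).
  by move=> /esym /(hP j g Fg).
exists i => j.
have /choice[s sP] : forall x : X i, exists f, F f /\ f i = x.
  by move=> x; have [f Ff fx] := iP x; exists f.
apply: (@injective_card_le _ _ (fun x => s x j)) => x y sxy.
have [Fx <-] := sP x; have [Fy <-] := sP y.
by rewrite (PF j _ _ Fx Fy sxy).
Qed.

Lemma card_le_total (T U : Type) :
  [set: T] #<= [set: U] \/ [set: U] #<= [set: T].
Proof.
have [[] bP] := min_card_family (fun b : bool => if b then T else U) true.
  by left; exact: (bP false).
by right; exact: (bP true).
Qed.

(* The family is indexed by subsets of [K0], rather than by the types in [C],
   to remain in the universe of [K0]. *)
Lemma is_least_card_exists (C : Type -> Prop) (K0 : Type) :
  C K0 -> exists K, is_least_card C K.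
Proof.
move=> CK0.
pose J := {A : K0 -> Prop | exists L, C L /\ [set: L] #= [set: {x | A x}]}.
have toI L : C L -> [set: L] #<= [set: K0] ->
    exists i : J, [set: L] #= [set: {x | sval i x}].
  move=> CL /card_leP[f].
  pose g (x : L) : K0 := val (f (SigSub (mem_set (I : [set: L] x)))).
  have ginj : injective g.
    by move=> x y /val_inj /(inj (in_setT _) (in_setT _)) [].
  pose A (y : K0) := exists x, g x = y.
  have e : [set: L] #= [set: {x | A x}].
    rewrite card_eq_le; apply/andP; split.
      apply: (@injective_card_le _ _
        (fun x => exist A (g x) (ex_intro _ x erefl))).
      by move=> x y [] /ginj.
    apply: (@injective_card_le _ _ (fun y : {x | A x} => sval (cid (svalP y)))).
    move=> y z yz; have yzK : sval y = sval z.
      by rewrite -(svalP (cid (svalP y))) yz; exact: svalP (cid (svalP z)).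
    by case: y z {yz} yzK => [y Ay] [z Az] /= yz; exact: eq_exist.
  by exists (exist _ A (ex_intro _ L (conj CL e))).
have [i0 _] := toI _ CK0 (card_lexx _).
have [i iP] := min_card_family (fun i : J => {x | sval i x}) i0.
have [K [CK Ki]] := svalP i; exists K; split=> // L CL.
rewrite (card_le_eql Ki).
have le_i M : C M -> [set: M] #<= [set: K0] ->
    [set: {x | sval i x}] #<= [set: M].
  by move=> CM /(toI _ CM)[j Mj]; rewrite (card_le_eqr Mj).
have [LK0|K0L] := card_le_total L K0; first exact: le_i.
exact: card_le_trans (le_i K0 CK0 (card_lexx _)) K0L.
Qed.

Lemma least_cardP (C : Type -> Prop) (K : Type) :
  C K -> is_least_card C (least_card C).
Proof.
move=> CK; rewrite /least_card; case: pselect => [e|[]].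
  exact: (svalP (cid e)).
exact: is_least_card_exists CK.
Qed.

Definition aleph1 : Type := least_card (fun K => ~ countable [set: K]).

Definition le_star (f g : nat -> nat) : Prop :=
  finite_set [set n | ~ (f n <= g n)%N].

Definition unbounded (F : set (nat -> nat)) : Prop :=
  ~ exists g, forall f, F f -> le_star f g.

Definition bounding_number : Type :=
  least_card (fun K => exists2 F, unbounded F & [set: K] #= F).

(* The notions of forcing below are stated for preorders, since Hechler forcing
   is not antisymmetric: the values of [f] on the domain of [s] are irrelevant
   in a condition [(s, f)]. *)
Section Forcing.
Context {d : Order.disp_t} (P : preorderType d).
Implicit Types (p q r : P) (A D : set P).

Definition compatible p q : Prop := exists r, (r <= p)%O /\ (r <= q)%O.

Definition antichain A : Prop :=
  forall p q, A p -> A q -> p <> q -> ~ compatible p q.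

Definition dense D : Prop := forall p, exists2 q, D q & (q <= p)%O.

Definition separative : Prop :=
  forall p q, ~~ (q <= p)%O -> exists2 r, (r <= q)%O & ~ compatible r p.

Definition saturation : Type :=
  least_card (fun K => forall A, antichain A -> A #< [set: K]).

Definition ccc : Prop := [set: saturation] #<= [set: aleph1].

Definition nt D : Type :=
  least_card (fun K => forall q, [set p | D p /\ (q <= p)%O] #< [set: K]).

Definition pi_nt : Type :=
  least_card (fun K => exists2 D, dense D & K = nt D).

End Forcing.

Definition hechler : Type := (seq nat * (nat -> nat))%type.

HB.instance Definition _ := Choice.copy hechler (seq nat * (nat -> nat))%type.

(* The finite sequence [t] has domain [{n | n < size t}]. *)
Definition hechler_le (q p : hechler) : bool :=
  let: (t, g) := q in let: (s, f) := p in
  `[< [/\ prefix s t,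
          forall n, (size t <= n)%N -> (f n <= g n)%N &
          forall n, (size s <= n)%N -> (n < size t)%N ->
            (f n <= nth 0 t n)%N] >].

Lemma hechler_le_refl : reflexive hechler_le.
Proof.
move=> [s f]; apply/asboolP; split=> [||n sn ns] //; first exact: prefix_refl.
by rewrite ltnNge sn in ns.
Qed.

Lemma hechler_le_trans : transitive hechler_le.
Proof.
move=> [t g] [u h] [s f] /asboolP[tu gh gu] /asboolP[st fg ft].
apply/asboolP; split=> [|n un|n sn nu]; first exact: prefix_trans tu.
  by rewrite (leq_trans _ (gh n un)) ?fg// (leq_trans (size_prefix tu)).
have [nt|tn] := ltnP n (size t).
  by have /prefixP[v ->] := tu; rewrite nth_cat nt ft.
by rewrite (leq_trans (fg n tn)) ?gu.
Qed.

Fact hechler_display : Order.disp_t. Proof. exact: (Order.Disp tt tt). Qed.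

HB.instance Definition _ := Order.Le_isPreorder.Build hechler_display hechler
  hechler_le_refl hechler_le_trans.

(* The classes of cardinals whose minimum is taken above are nonempty. *)

Lemma card_lt_powerset (T : Type) (A : set T) : A #< [set: T -> Prop].
Proof.
apply/andP; split.
  apply: (card_le_trans (card_leT A)); apply: (@injective_card_le _ _ set1).
  by move=> x y /(congr1 (@^~ x)) /= <-.
apply/negP => /card_set_bijP[f [_ _ fsurj]].
have [x Ax /(congr1 (@^~ x)) fx] := fsurj [set x | ~ f x x] I.
by have : f x x <-> ~ f x x by [rewrite {1}fx]; tauto.
Qed.

Lemma aleph1P :
  is_least_card (fun K => ~ countable [set: K]) aleph1.
Proof.
apply: (least_cardP (K := nat -> Prop)) => cnt.
by have /andP[+ /negP] := card_lt_powerset [set: nat];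
  rewrite card_eq_le => -> /=; apply.
Qed.

Lemma bounding_numberP :
  is_least_card (fun K => exists2 F, unbounded F & [set: K] #= F) bounding_number.
Proof.
apply: (@least_cardP _ (nat -> nat)); exists setT; last exact: card_eqxx.
case=> g /(_ (fun n => (g n).+1) I); rewrite /le_star.
have -> : [set n | ~ ((g n).+1 <= g n)%N] = setT.
  by apply/seteqP; split=> // n _ /=; rewrite ltnn.
exact: infinite_nat.
Qed.

Lemma saturationP d (P : preorderType d) :
  is_least_card (fun K => forall A : set P, antichain A -> A #< [set: K])
    (saturation P).
Proof. by apply: (@least_cardP _ (P -> Prop)) => A _; exact: card_lt_powerset. Qed.

Lemma ntP d (P : preorderType d) (D : set P) :
  is_least_card
    (fun K => forall q, [set p | D p /\ (q <= p)%O] #< [set: K]) (nt D).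
Proof. by apply: (@least_cardP _ (P -> Prop)) => q; exact: card_lt_powerset. Qed.

Lemma pi_ntP d (P : preorderType d) :
  is_least_card (fun K => exists2 D : set P, dense D & K = nt D) (pi_nt P).
Proof.
by apply: (@least_cardP _ (nt [set: P])); exists setT => // p; exists p.
Qed.

(* Main.v *)
(* Conditions with the same stem are compatible, so antichains are countable.
   Now let D be dense and K uncountable with K < b; we look for K elements of D
   above a single condition.  The second components of the conditions of D form
   an unbounded family, hence so do those with some fixed stem t; being
   unbounded survives countable partitions, which gives a function x such that
   for each n the functions agreeing with x below n are still unbounded in the
   family, so at least b > K of them.  A suitable choice of K of these functions
   is bounded everywhere by some G, and (t, G) is the required condition.
   The final claim applies this to the antisymmetric quotient of Hechler
   forcing, which is a separative ccc poset. *)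
From HB Require Import structures.
Require Import Defs.
From mathcomp Require Import all_boot all_order.
From mathcomp Require Import boolp classical_sets functions cardinality.

Set Implicit Arguments.
Unset Strict Implicit.
Unset Printing Implicit Defensive.

Local Open Scope classical_set_scope.
Local Open Scope card_scope.

(** * Cardinal comparison of sets and countable unions *)

Lemma card_le_injection (T V : Type) (A : set T) (U : set V) (u0 : V) :
  U u0 -> A #<= U ->
  exists f : T -> V, (forall x, U (f x)) /\
    forall x y, A x -> A y -> f x = f y -> x = y.
Proof.
move=> Uu0 /card_leP[h].
pose f x := if pselect (A x) is left Ax then val (h (SigSub (mem_set Ax))) else u0.
exists f; split=> [x|x y Ax Ay]; rewrite /f.
  by case: pselect => // Ax; apply: set_mem (valP _).
case: pselect => // Ax'; case: pselect => // Ay' /val_inj.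
by move=> /(inj (in_setT _) (in_setT _)) [].
Qed.

Lemma injection_card_le (T V : Type) (A : set T) (U : set V) (f : T -> V) :
  (forall x, A x -> U (f x)) ->
  (forall x y, A x -> A y -> f x = f y -> x = y) -> A #<= U.
Proof.
move=> AU finj; have fA : f @` A #= A.
  by apply: inj_card_eq => x y /set_mem Ax /set_mem Ay; exact: finj.
rewrite -(card_le_eql fA); apply: subset_card_le => _ [x Ax <-]; exact: AU.
Qed.

(* Cover all but finitely many elements of [U] by a maximal family of pairwise
   disjoint sequences, and split each sequence into countably many. *)
Lemma infinite_card_setXnat (V : Type) (U : set V) :
  infinite_set U -> [set: nat] `*` U #<= U.
Proof.
move=> Uinf.
pose seqU (f : nat -> V) := injective f /\ forall n, U (f n).
pose P (F : set (nat -> V)) := F `<=` seqU /\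
  forall f g n m, F f -> F g -> f n = g m -> f = g.
have [F [[FU Fdisj] maxF]] : exists F, P F /\ forall G, F `<` G -> ~ P G.
  apply: Zorn_bigcup => S SP totS; split=> [f [A SA Af]|].
    exact: (SP _ SA).1.
  move=> f g n m [A SA Af] [B SB Bg].
  have [AB|BA] := totS _ _ SA SB.
    exact: (SP _ SB).2 (AB _ Af) Bg.
  exact: (SP _ SA).2 Af (BA _ Bg).
pose R := [set u | U u /\ forall f n, F f -> f n <> u].
have infR : finite_set R.
  apply: contrapT => infR; have [r0 Rr0] := infinite_setN0 infR.
  move/infiniteP: infR => /(card_le_injection Rr0)[h [hR hinj]].
  have {}hinj : injective h by move=> n m; exact: hinj.
  apply: (maxF (F `|` [set h])).
    split=> [f|FhF]; first by left.
    have Fh : F h by apply: FhF; right.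
    by have [_ /(_ h 0 Fh)] := hR 0.
  split=> [f [/FU//|->]|f g n m [Ff|->] [Fg|->] //].
  - by split=> // n; have [] := hR n.
  - exact: Fdisj.
  - by have [_ /(_ f n Ff)] := hR m.
  - by have [_ /(_ g m Fg) + /esym] := hR n.
have [f0 Ff0] : F !=set0.
  apply: contrapT => /set0P/negP/negPn/eqP F0; apply: Uinf.
  by apply: sub_finite_set infR => u Uu; split=> // f n; rewrite F0.
have [c cinj] : exists c : V -> nat, forall u v, R u -> R v -> c u = c v -> u = v.
  have /countable_injP[c cinj] := finite_set_countable infR.
  by exists c => u v Ru Rv; apply: cinj; exact: mem_set.
have /choice[k kP] (u : V) : exists fn : (nat -> V) * nat, U u -> ~ R u ->
    F fn.1 /\ fn.1 fn.2 = u.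
  have [Uu|] := pselect (U u); last by exists (f0, 0).
  have [|Ru] := pselect (R u); first by exists (f0, 0).
  apply: contrapT => /forallNP noc; apply: Ru; split=> // f n Ff fnu.
  by apply: (noc (f, n)).
(* The pair [(n, u)] goes to a coded position in the sequence through [u], or in [f0] when [u] lies
   in the remainder [R]. The boolean tag separates the two uses of [f0]. *)
pose phi (x : nat * V) : V :=
  if `[< R x.2 >] then f0 (pickle (false, x.1, c x.2))
  else (k x.2).1 (pickle (true, x.1, (k x.2).2)).
apply: (@injection_card_le _ _ _ _ phi) => [[n u] [_ /= Uu]|].
  rewrite /phi; case: asboolP => /= Ru; first by have [_] := FU _ Ff0.
  by have [/FU[_]] := kP u Uu Ru.
move=> [n u] [m v] [_ /= Uu] [_ /= Uv]; rewrite /phi /=.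
have pkinj := pcan_inj (@pickleK (bool * nat * nat)%type).
case: asboolP => Ru; case: asboolP => Rv; last first.
- have [Fu ku] := kP u Uu Ru; have [Fv kv] := kP v Uv Rv => e.
  have kuv := Fdisj _ _ _ _ Fu Fv e.
  move: e; rewrite -kuv => /(FU _ Fu).1/pkinj[-> kuv2].
  by rewrite -ku -kv -kuv kuv2.
- have [Fu ku] := kP u Uu Ru => e; have ku0 := Fdisj _ _ _ _ Fu Ff0 e.
  by move: e; rewrite ku0 => /(FU _ Ff0).1/pkinj.
- have [Fv kv] := kP v Uv Rv => e; have kv0 := Fdisj _ _ _ _ Ff0 Fv e.
  by move: e; rewrite -kv0 => /(FU _ Ff0).1/pkinj.
- by move=> /(FU _ Ff0).1/pkinj[-> /cinj ->].
Qed.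

(** As [X] is uncountable, [U] must be infinite, so it absorbs a factor [nat]: a point of [X] is
    coded by the index of a piece containing it and its image in [U]. *)
Lemma uncountable_bigcup_card_le (T V : Type) (X : set T) (Y : nat -> set T)
    (U : set V) :
  ~ countable X -> X `<=` \bigcup_n Y n -> (forall n, Y n #<= U) -> X #<= U.
Proof.
move=> Xunc XY YU.
have Uinf : infinite_set U.
  move=> /finite_set_countable cU; apply: Xunc.
  apply: sub_countable (subset_card_le XY) _.
  by apply: bigcup_countable => // n _; exact: card_le_trans (YU n) cU.
have [u0 Uu0] := infinite_setN0 Uinf.
have /choice[f fP] := fun n => card_le_injection Uu0 (YU n).
have [t0 Xt0] : X !=set0.
  by apply: contrapT => /set0P/negP/negPn/eqP X0; apply: Xunc; rewrite X0.
have /choice[r rP] (x : T) : exists n, X x -> Y n x.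
  have [/XY[n _ Yx]|nX] := pselect (X x); first by exists n.
  by exists 0.
apply: card_le_trans (infinite_card_setXnat Uinf).
apply: (@injection_card_le _ _ _ _ (fun x => (r x, f (r x) x))) => [x _|x y Xx Xy].
  by split=> //=; exact: (fP _).1.
move=> [rxy]; rewrite -rxy; apply: (fP _).2; first exact: rP.
by rewrite rxy; exact: rP.
Qed.

Lemma card_set_le_total (T V : Type) (A : set T) (B : set V) :
  A #<= B \/ B #<= A.
Proof.
have := card_le_total (set_type A) (set_type B).
by rewrite !(card_le_eql (card_setT _)) !(card_le_eqr (card_setT _)).
Qed.

Lemma card_ltNge (T V : Type) (A : set T) (B : set V) : A #< B -> ~ (B #<= A).
Proof. by move=> /andP[AB /negP + BA]; apply; rewrite card_eq_le AB. Qed.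

Lemma card_nle_lt (T V : Type) (A : set T) (B : set V) : ~ (B #<= A) -> A #< B.
Proof.
move=> nBA; have [AB|//] := card_set_le_total A B.
by apply/andP; split=> //; apply/negP; rewrite card_eq_le => /andP[_].
Qed.

(** * Eventual domination and unbounded families *)

Lemma le_starP (f g : nat -> nat) :
  le_star f g <-> exists N, forall n, (N <= n)%N -> (f n <= g n)%N.
Proof.
split=> [/finite_seqP[s sE]|[N fg]].
  exists (\max_(i <- s) i).+1 => n sn; apply: contrapT => nfg.
  have : n \in s by have : [set` s] n by rewrite -sE.
  by move=> ns; move: sn; rewrite ltnNge (leq_bigmax_seq (F := id)).
apply: sub_finite_set (finite_II N) => n /= nfg.
by rewrite ltnNge; apply/negP => /fg.
Qed.

Lemma le_star_addc (f g : nat -> nat) :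
  le_star f g -> exists c, forall n, (f n <= g n + c)%N.
Proof.
move=> /le_starP[N fg]; exists (\sum_(i < N) f i)%N => n.
have [/fg fgn|nN] := leqP N n; first exact: leq_trans (leq_addr _ _).
rewrite (leq_trans _ (leq_addl _ _))// (bigD1 (Ordinal nN))//=.
exact: leq_addr.
Qed.

(** A diagonal sum: at [j], only the [G t] with code at most [j] are added, so each [G t] is
    dominated from the code of [t] on. *)
Lemma le_star_countable_ub (T : countType) (G : T -> nat -> nat) :
  exists g, forall t, le_star (G t) g.
Proof.
exists (fun j => \sum_(i < j.+1) oapp (G^~ j) 0 (choice.unpickle i))%N => t.
apply/le_starP; exists (choice.pickle t) => n tn.
rewrite (bigD1 (Ordinal (tn : (_ < n.+1)%N)))//= choice.pickleK /=.
exact: leq_addr.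
Qed.

Lemma unbounded_bigcup (T : countType) (F : T -> set (nat -> nat)) :
  unbounded (\bigcup_t F t) -> exists t, unbounded (F t).
Proof.
move=> unbF; apply: contrapT => /forallNP bndF; apply: unbF.
have /choice[G GP] : forall t, exists g, forall f, F t f -> le_star f g.
  by move=> t; exact: contrapT (bndF t).
have [g gP] := le_star_countable_ub G; exists g => f [t _ /GP].
move=> /le_starP[N fG]; have /le_starP[M Gg] := gP t.
apply/le_starP; exists (maxn N M) => n; rewrite geq_max => /andP[Nn Mn].
exact: leq_trans (fG n Nn) (Gg n Mn).
Qed.

Lemma not_unbounded0 : ~ unbounded set0.
Proof. by apply; exists (fun=> 0%N). Qed.

Lemma unbounded_uncountable (F : set (nat -> nat)) : unbounded F -> ~ countable F.
Proof.
move=> unbF /countable_injP[c cinj].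
(* The fibres of [c] on [F] have at most one element, hence are bounded. *)
have [|n] := @unbounded_bigcup nat (fun n => [set f | F f /\ c f = n]).
  by apply: contra_not unbF => -[g gP]; exists g => f Ff; apply: gP; exists (c f).
apply; have [[f [Ff cf]]|none] := pselect ([set f | F f /\ c f = n] !=set0).
  exists f => f' [Ff' cf']; have -> : f' = f.
    by apply: cinj; rewrite ?inE// cf'.
  by apply/le_starP; exists 0%N.
by exists (fun=> 0%N) => f Ff; case: none; exists f.
Qed.

Lemma aleph1_uncountable : ~ countable [set: aleph1].
Proof. by have [] := aleph1P. Qed.

Lemma aleph1_le_uncountable (K : Type) :
  ~ countable [set: K] -> [set: aleph1] #<= [set: K].
Proof. by have [_] := aleph1P; apply. Qed.

Lemma aleph1_le_bounding_number : [set: aleph1] #<= [set: bounding_number].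
Proof.
apply: aleph1_le_uncountable; have [[F unbF bF] _] := bounding_numberP.
by rewrite (eq_countable bF); exact: unbounded_uncountable.
Qed.

Lemma countable_card_lt_aleph1 (T : Type) (A : set T) :
  countable A -> A #< [set: aleph1].
Proof.
move=> cA; apply: card_nle_lt => /card_le_trans/(_ cA).
exact: aleph1_uncountable.
Qed.

Lemma bounding_number_le_unbounded (F : set (nat -> nat)) :
  unbounded F -> [set: bounding_number] #<= F.
Proof.
move=> unbF; have [_ /(_ (set_type F))] := bounding_numberP.
by rewrite (card_le_eqr (card_setT _)); apply; exists F => //; exact: card_setT.
Qed.

(** Otherwise every [x] in [H] has an initial segment [s] with [agree s] bounded, and these
    countably many bounded pieces cover [H]. *)
Lemma unbounded_condensation (H : set (nat -> nat)) : unbounded H ->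
  exists x, forall n, unbounded [set h | H h /\ forall j, (j < n)%N -> h j = x j].
Proof.
move=> unbH; pose agree (s : seq nat) :=
  [set h | H h /\ forall j, (j < size s)%N -> h j = nth 0 s j].
apply: contrapT => /forallNP noH.
have [|s] := @unbounded_bigcup _
    (fun s => [set h | agree s h /\ ~ unbounded (agree s)]).
  apply: contra_not unbH => -[g gP]; exists g => x Hx; apply: gP.
  have /existsNP[n bnd] := noH x; exists (mkseq x n) => //=.
  have e : agree (mkseq x n) = [set h | H h /\ forall j, (j < n)%N -> h j = x j].
    apply/seteqP; split=> h [Hh hx]; split=> // j; move: (hx j);
      rewrite size_mkseq => + jn; move=> /(_ jn); by rewrite nth_mkseq.
  by rewrite e.
have [unbs|bnds] := pselect (unbounded (agree s)).
  have -> : [set h | agree s h /\ ~ unbounded (agree s)] = set0.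
    by apply/seteqP; split=> // h [].
  exact: not_unbounded0.
by apply; move/contrapT: bnds => [g gP]; exists g => f [/gP].
Qed.

(* For [n = 0, 1, ...] take [K] functions of [H] agreeing with [x] below [n],
   dominated by a single [g n] modulo finite, and classify them by the constant
   [c] for which they are below [g n + c] everywhere.  If no class has size [K],
   then the classes of the [n]-th family are cofinal below [K], so that one may
   choose [c n] making the [n]-th class as large as the [n]-th class of the
   [0]-th family.  Only the [n <= j] matter at [j], so that the union of the
   chosen classes is bounded; no regularity of [K] is needed. *)
Lemma unbounded_large_bounded_subset (H : set (nat -> nat)) (K : Type) :
  unbounded H -> ~ countable [set: K] -> [set: K] #< [set: bounding_number] ->
  exists G : nat -> nat, [set: K] #<= [set h | H h /\ forall n, (h n <= G n)%N].
Proof.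
move=> unbH Kunc Kb; apply: contrapT => /forallNP small.
have [x xP] := unbounded_condensation unbH.
pose Hn n := [set h | H h /\ forall j, (j < n)%N -> h j = x j].
have /choice[Y YP] n : exists Y : set (nat -> nat), Y `<=` Hn n /\ [set: K] #= Y.
  have unbn := xP n; have [h0 Hh0] : Hn n !=set0.
    apply: contrapT => /set0P/negP/negPn/eqP Hn0.
    by move: unbn; rewrite -/(Hn n) Hn0 => /not_unbounded0.
  have /andP[/card_le_trans/(_ (bounding_number_le_unbounded unbn)) + _] := Kb.
  move=> /(card_le_injection Hh0)[f [fH finj]]; exists (range f).
  split=> [_ [k _ <-]//|]; rewrite card_eq_sym; apply: inj_card_eq => k l _ _.
  exact: finj.
have Yunc n : ~ countable (Y n) by rewrite -(eq_countable (YP n).2).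
have /choice[g gP] n : exists g, forall h, Y n h -> le_star h g.
  apply: contrapT => /bounding_number_le_unbounded.
  by rewrite -(card_le_eqr (YP n).2); exact: card_ltNge.
pose Yc n c := [set h | Y n h /\ forall j, (h j <= g n j + c)%N].
have YcU n : Y n `<=` \bigcup_c Yc n c.
  by move=> h Yh; have [c hc] := le_star_addc (gP n h Yh); exists c.
have /choice[c cP] n : exists c, Yc 0 n #<= Yc n c.
  (* Otherwise every class of [Y n] injects into [Yc 0 n], hence so does [K], although [Yc 0 n] is
     bounded by [g 0 + n]. *)
  apply: contrapT => /forallNP nc; apply: (small (fun j => g 0 j + n)%N).
  rewrite (card_le_eql (YP n).2); apply: card_le_trans (subset_card_le _).
    apply: (@uncountable_bigcup_card_le _ _ _ (Yc n) (Yc 0 n)) => // m.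
    by have [/nc|] := card_set_le_total (Yc 0 n) (Yc n m).
  by move=> h [Yh hc]; split=> //; exact: ((YP 0).1 h Yh).1.
apply: (small (fun j => x j + \sum_(n < j.+1) (g n j + c n))%N).
rewrite (card_le_eql (YP 0).2).
apply: (@uncountable_bigcup_card_le _ _ _ (Yc 0)) => // n.
apply: card_le_trans (cP n) (subset_card_le _) => h [/(YP n).1[Hh hx] hc].
split=> // j; have [/hx ->|nj] := ltnP j n; first exact: leq_addr.
rewrite (leq_trans (hc j))// (leq_trans _ (leq_addl _ _))//.
by rewrite (bigD1 (Ordinal (nj : (_ < j.+1)%N)))//= leq_addr.
Qed.

(** * Hechler conditions: large lower bounds and separativity *)

Lemma hechler_leP (t s : seq nat) (g f : nat -> nat) :
  reflect [/\ prefix s t, forall n, (size t <= n)%N -> (f n <= g n)%N &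
      forall n, (size s <= n)%N -> (n < size t)%N -> (f n <= nth 0 t n)%N]
    (((t, g) : hechler) <= ((s, f) : hechler))%O.
Proof. exact: asboolP. Qed.

Lemma hechler_le_stem (s : seq nat) (g f : nat -> nat) :
  (forall n, f n <= g n)%N -> (((s, g) : hechler) <= ((s, f) : hechler))%O.
Proof.
move=> fg; apply/hechler_leP; split=> // [|n sn ns]; first exact: prefix_refl.
by rewrite ltnNge sn in ns.
Qed.

Lemma prefix_nth (s t : seq nat) n :
  prefix s t -> (n < size s)%N -> nth 0 t n = nth 0 s n.
Proof. by move=> /prefixP[u ->] ns; rewrite nth_cat ns. Qed.

Lemma hechler_large_lower_bound (E : set hechler) (K : Type) :
  (forall f, exists2 p, E p & (p <= (([::], f) : hechler))%O) ->
  ~ countable [set: K] -> [set: K] #< [set: bounding_number] ->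
  exists q : hechler, [set: K] #<= [set p | E p /\ (q <= p)%O].
Proof.
move=> denseE Kunc Kb.
have [|t unbt] := @unbounded_bigcup _ (fun t => [set h | E (t, h)]).
  (* Past its stem, a condition below [([::], g + 1)] has second component above [g], so [g] cannot
     bound it. *)
  move=> [g gP]; have [[t h] Eth] := denseE (fun n => (g n).+1).
  move=> /hechler_leP[_ hg _]; have := gP h; case; first by exists t.
  move=> n; have /le_starP := gP h (ex_intro2 _ _ t I Eth).
  move=> [N hN]; have := hN _ (leq_maxl N (size t)).
  by rewrite leqNgt hg// leq_maxr.
have [G KG] := unbounded_large_bounded_subset unbt Kunc Kb.
exists (t, G); apply: card_le_trans KG _.
apply: (@injection_card_le _ _ _ _ (fun h => (t, h) : hechler)).
  by move=> h [Eth hG]; split=> //; exact: hechler_le_stem.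
by move=> h k _ _ [].
Qed.

(** Four causes of failure are treated in turn: [t] is shorter than [s], does not extend [s], has an
    entry below [f] past [s], or [g] drops below [f] past [t]. In the second and third, [(t, g)]
    itself is the witness. *)
Lemma separative_hechler : separative hechler.
Proof.
move=> [s f] [t g] nle.
have [st|ts] := leqP (size s) (size t); last first.
  (* Large enough to be allowed by [g], and different from the entry of [s] at [size t]. *)
  pose k := (g (size t) + (nth 0 s (size t)).+1)%N.
  exists (rcons t k, g).
    apply/hechler_leP; split=> [|//|n tn]; first exact: prefix_rcons.
    rewrite size_rcons ltnS => nt; have -> : n = size t.
      by apply/eqP; rewrite eqn_leq nt.
    by rewrite nth_rcons ltnn eqxx leq_addr.
  move=> [[u h] [/hechler_leP[tu _ _] /hechler_leP[su _ _]]].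
  have := prefix_nth tu (n := size t); rewrite size_rcons => /(_ (leqnn _)).
  rewrite (prefix_nth su ts) nth_rcons ltnn eqxx => e.
  by have := leq_addl (g (size t)) (nth 0 s (size t)).+1; rewrite -/k -e ltnn.
have [pst|npst] := boolP (prefix s t); last first.
  exists (t, g) => // -[[u h] [/hechler_leP[tu _ _] /hechler_leP[su _ _]]].
  move/negP: npst; apply; rewrite prefixE.
  by move: tu su; rewrite !prefixE => /eqP <- /eqP su; rewrite take_takel// su.
have [tf|] := pselect (forall n, (size s <= n)%N -> (n < size t)%N ->
    (f n <= nth 0 t n)%N); last first.
  move=> /existsNP[n /not_implyP[sn /not_implyP[nt /negP nf]]].
  exists (t, g) => // -[[u h] [/hechler_leP[tu _ _] /hechler_leP[su _ uf]]].
  move: nf; rewrite -(prefix_nth tu nt) uf// (leq_trans nt)//.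
  exact: size_prefix.
have [n tn nfg] : exists2 n, (size t <= n)%N & ~~ (f n <= g n)%N.
  apply: contrapT => nofg; move/negP: nle; apply; apply/hechler_leP.
  split=> // n tn; apply/negPn/negP => nfg; apply: nofg.
  by exists n.
(* Appending values of [g] up to [n] fixes the entry [g n < f n] in the stem, which excludes any
   common extension with [(s, f)]. *)
pose t' := t ++ [seq g i | i <- iota (size t) (n.+1 - size t)].
have st' : size t' = n.+1 by rewrite size_cat size_map size_iota subnKC// ltnW.
have nt' i : (size t <= i)%N -> (i < n.+1)%N -> nth 0 t' i = g i.
  move=> ti ni; rewrite nth_cat ltnNge ti /= (nth_map 0).
    by rewrite nth_iota ?subnKC// ltn_sub2r// (leq_ltn_trans ti).
  by rewrite size_iota ltn_sub2r// (leq_ltn_trans ti).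
exists (t', g).
  apply/hechler_leP; split=> [|//|i ti]; first exact: prefix_prefix.
  by rewrite st' => ni; rewrite nt'.
move=> [[u h] [/hechler_leP[tu _ _] /hechler_leP[_ _ uf]]].
have nu : (n < size u)%N by rewrite -st'; exact: size_prefix.
move: nfg; rewrite -(nt' n)// -(prefix_nth tu) ?st'// uf//.
exact: leq_trans tn.
Qed.

(* [e] exhibits [P] as Hechler forcing up to equivalence of conditions; this
   covers both [hechler] and its antisymmetric version. *)
Section HechlerRepresentation.
Context {d : Order.disp_t} (P : preorderType d) (e : P -> hechler).
Hypothesis e_le : forall p q, (e p <= e q)%O = (p <= q)%O.
Hypothesis e_equiv : forall r, exists p, (e p <= r)%O /\ (r <= e p)%O.

Lemma saturation_representation : [set: saturation P] #<= [set: aleph1].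
Proof.
apply: (saturationP P).2 => A antiA; apply: countable_card_lt_aleph1.
apply: (@sub_countable _ _ _ [set: seq nat]) => //.
apply: (@injection_card_le _ _ _ _ (fun p => (e p).1)) => // p q Ap Aq epq.
apply: contrapT => /(antiA p q Ap Aq); apply.
move: (e_le^~ p) (e_le^~ q) epq; case: (e p) (e q) => [s f] [t g] lep leq /= st.
rewrite {}st in lep *.
have [r [er _]] := e_equiv (t, fun n => (f n + g n)%N).
by exists r; rewrite -lep -leq; split; apply: Order.PreorderTheory.le_trans er _;
  apply: hechler_le_stem => n; rewrite ?leq_addr ?leq_addl.
Qed.

Lemma separative_representation : separative P.
Proof.
move=> p q; rewrite -e_le => /separative_hechler[r req nrp].
have [r' [r'r rr']] := e_equiv r; exists r'.
  by rewrite -e_le; apply: Order.PreorderTheory.le_trans r'r req.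
move=> [w [wr' wp]]; apply: nrp; exists (e w); split; last by rewrite e_le.
by apply: Order.PreorderTheory.le_trans r'r; rewrite e_le.
Qed.

Lemma large_lower_bound_representation (D : set P) (K : Type) :
  dense D -> ~ countable [set: K] -> [set: K] #< [set: bounding_number] ->
  exists q : P, [set: K] #<= [set p | D p /\ (q <= p)%O].
Proof.
move=> denseD Kunc Kb.
have [f|q Kq] := @hechler_large_lower_bound (e @` D) K _ Kunc Kb.
  have [p0 [p0f _]] := e_equiv ([::], f); have [p Dp pp0] := denseD p0.
  exists (e p); first by exists p.
  by apply: Order.PreorderTheory.le_trans p0f; rewrite e_le.
have [q' [q'q _]] := e_equiv q; exists q'.
(* [e] need not be injective: an image is never larger than its source. *)
apply: card_le_trans Kq (card_le_trans (subset_card_le _) (card_image_le e _)).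
move=> _ [[p Dp <-] qp]; exists p => //; split=> //.
by rewrite -e_le; exact: Order.PreorderTheory.le_trans qp.
Qed.

(** If [nt D] were below the bounding number, some [q] would have too many elements of [D] above it:
    at least [aleph1] if [nt D] is countable, at least [nt D] otherwise. *)
Lemma pi_nt_representation : [set: aleph1] #< [set: bounding_number] ->
  [set: bounding_number] #<= [set: pi_nt P].
Proof.
move=> alb; have [[D denseD ->] _] := pi_ntP P.
have [ntD _] := ntP D; apply: contrapT => /card_nle_lt ntb.
have [cnt|unc] := pselect (countable [set: nt D]).
  have [q alq] := large_lower_bound_representation denseD aleph1_uncountable alb.
  have /andP[qnt _] := ntD q.
  exact: aleph1_uncountable (card_le_trans alq (card_le_trans qnt cnt)).
have [q ntq] := large_lower_bound_representation denseD unc ntb.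
exact: card_ltNge (ntD q) ntq.
Qed.

End HechlerRepresentation.

(* Normalizing the irrelevant values of the second component to [0] picks one
   condition in each class of the separative quotient. *)
Definition normal_hechler : Type :=
  {p : hechler | `[< forall n, (n < size p.1)%N -> p.2 n = 0 >]}.

HB.instance Definition _ := Choice.copy normal_hechler
  {p : hechler | `[< forall n, (n < size p.1)%N -> p.2 n = 0 >]}.

Definition normal_hechler_le (q p : normal_hechler) : bool :=
  (sval q <= sval p)%O.

Lemma normal_hechler_le_refl : reflexive normal_hechler_le.
Proof. by move=> p; exact: Order.PreorderTheory.lexx. Qed.

Lemma normal_hechler_le_trans : transitive normal_hechler_le.
Proof. by move=> q p r; exact: Order.PreorderTheory.le_trans. Qed.

Lemma normal_hechler_le_anti : antisymmetric normal_hechler_le.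
Proof.
move=> [[s f] /= nf] [[t g] /= ng].
move=> /andP[/hechler_leP[ts gf _] /hechler_leP[st fg _]]; apply: val_inj => /=.
have {}st : s = t.
  apply/eqP; move: (st); rewrite prefixE take_oversize// 1?eq_sym//.
  exact: size_prefix.
rewrite -{}st in gf fg ng *; congr pair; apply/funext => n.
have [ns|sn] := ltnP n (size s).
  by rewrite (asboolP _ nf) ?(asboolP _ ng).
by apply/eqP; rewrite eqn_leq fg ?gf.
Qed.

Fact normal_hechler_display : Order.disp_t. Proof. exact: (Order.Disp tt tt). Qed.

HB.instance Definition _ := Order.Le_isPOrder.Build normal_hechler_display
  normal_hechler normal_hechler_le_refl normal_hechler_le_anti
  normal_hechler_le_trans.

Lemma normal_hechler_equiv (r : hechler) :
  exists p : normal_hechler, (sval p <= r)%O /\ (r <= sval p)%O.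
Proof.
case: r => s f; pose f0 n := if (n < size s)%N then 0 else f n.
have nf : `[< forall n, (n < size (s, f0).1)%N -> (s, f0).2 n = 0 >].
  by apply/asboolP => n /= ns; rewrite /f0 ns.
exists (exist _ (s, f0) nf); split; apply/hechler_leP;
  split; rewrite ?prefix_refl// => n sn.
- by rewrite /f0 ltnNge sn.
- by rewrite ltnNge sn.
- by rewrite /f0 ltnNge sn.
- by rewrite ltnNge sn.
Qed.

Theorem theorem4p1 :
  [/\ ccc hechler,
      [set: aleph1] #< [set: bounding_number] -> [set: bounding_number] #<= [set: pi_nt hechler] &
      (forall (d : Order.disp_t) (P : porderType d),
          ccc P -> separative P -> [set: pi_nt P] #<= [set: saturation P]) ->
      [set: bounding_number] #= [set: aleph1]].
Proof.
have idP (r : hechler) : exists p, (id p <= r)%O /\ (r <= id p)%O.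
  by exists r; rewrite Order.PreorderTheory.lexx.
split.
- exact: (@saturation_representation _ hechler id).
- exact: (@pi_nt_representation _ hechler id).
move=> pi_nt_le; have e_le (p q : normal_hechler) : (sval p <= sval q)%O = (p <= q)%O by [].
have cccN := saturation_representation e_le normal_hechler_equiv.
have sepN := separative_representation e_le normal_hechler_equiv.
rewrite card_eq_le aleph1_le_bounding_number andbT.
(* Otherwise the bounding number is at most [pi_nt], hence at most the saturation, hence at most
   [aleph1]. *)
apply: contrapT => /card_nle_lt alb; apply: (card_ltNge alb).
apply: card_le_trans (pi_nt_representation e_le normal_hechler_equiv alb) _.
exact: card_le_trans (pi_nt_le _ _ cccN sepN) cccN.
Qed.
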